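(* Let $n\ge 1$ and let $F:\mathrm{LC}_n\to\mathbb{R}$ be a linear and increasing functional. Then $F(f)=0$ for all $f\in\mathrm{LC}_n$.
   Context: A function $f:\mathbb{R}^n\to[0,\infty)$, not identically $0$, is log-concave if $f((1-\lambda)x+\lambda y)\ge f(x)^{1-\lambda}f(y)^{\lambda}$ for all $x,y\in\mathbb{R}^n$ and $0\le\lambda\le1$; equivalently $f=e^{-\phi}$ with $\phi:\mathbb{R}^n\to(-\infty,\infty]$ convex and not identically $+\infty$. $\mathrm{LC}_n$ is the class of all upper semi-continuous log-concave functions on $\mathbb{R}^n$. For $f,g\in\mathrm{LC}_n$ the sup-convolution is $(f\star g)(x)=\sup_{y\in\mathbb{R}^n} f(y)g(x-y)$; if it is finite but not upper semi-continuous, $f\star g$ denotes its closure (upper semi-continuous hull); if it takes the value $+\infty$ it is not an element of $\mathrm{LC}_n$. For $\lambda>0$ the dilation is $(\lambda\cdot f)(x)=f(x/\lambda)^{\lambda}$. A functional $F:\mathrm{LC}_n\to\mathbb{R}$ is linear if $F((\alpha\cdot f)\star(\beta\cdot g))=\alpha F(f)+\beta F(g)$ for all $f,g\in\mathrm{LC}_n$ and all $\alpha,\beta>0$ such that $(\alpha\cdot f)\star(\beta\cdot g)\in\mathrm{LC}_n$. It is increasing if $f\ge g$ pointwise implies $F(f)\ge F(g)$. *)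

(* Defs.v *)
From HB Require Import structures.
From mathcomp Require Import all_boot all_order all_algebra.
From mathcomp Require Import all_classical all_reals all_analysis.
Set Implicit Arguments.
Unset Strict Implicit.
Unset Printing Implicit Defensive.
Import Order.TTheory GRing.Theory Num.Theory.
Import numFieldNormedType.Exports.
Local Open Scope classical_set_scope.
Local Open Scope ring_scope.

(* The library convention 0 `^ 0 = 1 makes the inequality hold trivially at
   l = 0 and l = 1. *)
Definition log_concave (R : realType) (n : nat) (f : 'rV[R]_n -> R) : Prop :=
  [/\ forall x, 0 <= f x,
      exists x, f x != 0 &
      forall (x y : 'rV[R]_n) (l : R), 0 <= l <= 1 ->
        f x `^ (1 - l) * f y `^ l <= f ((1 - l) *: x + l *: y)].

Definition upper_semicontinuous (T : topologicalType) (R : realType)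
    (f : T -> R) : Prop :=
  lower_semicontinuous (fun x => (- f x)%:E).

Record LC (R : realType) (n : nat) := MkLC {
  LC_fun :> 'rV[R]_n -> R;
  LC_log_concave : log_concave LC_fun;
  LC_usc : upper_semicontinuous LC_fun }.

Definition sup_convolution_raw (R : realType) (n : nat) (f g : 'rV[R]_n -> R)
    (x : 'rV[R]_n) : \bar R :=
  ereal_sup [set (f y * g (x - y))%:E | y in [set: 'rV[R]_n]].

(* The neighbourhoods of x are not punctured, so this is the least upper
   semicontinuous majorant of phi. *)
Definition usc_hull (T : topologicalType) (R : realType) (phi : T -> \bar R)
    (x : T) : \bar R :=
  limf_esup phi (nbhs x).

Lemma usc_hull_ge (T : topologicalType) (R : realType) (phi : T -> \bar R)
    (x : T) : (phi x <= usc_hull phi x)%E.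
Proof.
apply: le_ereal_inf_tmp => _ [V xV <-].
by apply: ereal_sup_ubound; exists x => //; exact: nbhs_singleton.
Qed.

Lemma usc_hull_id (T : topologicalType) (R : realType) (f : T -> R) :
  upper_semicontinuous f -> usc_hull (EFin \o f) = EFin \o f.
Proof.
move=> fusc; apply/funext => x; apply/le_anti/andP; split; last first.
  exact: usc_hull_ge.
apply/lee_addgt0Pr => e e0.
have [|V xV Vf] := fusc x (- (f x + e)).
  by rewrite lte_fin ltrN2 ltrDl.
apply: (@le_trans _ _ (ereal_sup ((EFin \o f) @` V))).
  by apply: ereal_inf_lbound; exists V.
apply: ge_ereal_sup => _ [y /Vf + <-] /=.
by rewrite lte_fin ltrN2 lee_fin => /ltW.
Qed.

(* By usc_hull_id, taking the hull changes nothing when the supremum is finite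
   and upper semicontinuous; by usc_hull_ge, a value +oo of the supremum
   persists, so that the result is then not (the image of) an element of LC. *)
Definition sup_convolution (R : realType) (n : nat) (f g : 'rV[R]_n -> R) :
    'rV[R]_n -> \bar R :=
  usc_hull (sup_convolution_raw f g).

Definition dilation (R : realType) (n : nat) (l : R) (f : 'rV[R]_n -> R) :
    'rV[R]_n -> R :=
  fun x => f (l^-1 *: x) `^ l.

(* h ranges over LC R n, so the premise on h says exactly that the
   sup-convolution belongs to the class and that h is that function. *)
Definition linear_functional (R : realType) (n : nat) (F : LC R n -> R) : Prop :=
  forall (f g h : LC R n) (a b : R), 0 < a -> 0 < b ->
    sup_convolution (dilation a f) (dilation b g) = (fun x => (h x)%:E) ->
    F h = a * F f + b * F g.

Definition increasing_functional (R : realType) (n : nat) (F : LC R n -> R) :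
    Prop :=
  forall f g : LC R n, (forall x, g x <= f x) -> F g <= F f.

(* Main.v *)
Require Import Defs.
From mathcomp Require Import all_boot all_order all_algebra.
From mathcomp Require Import all_classical all_reals all_analysis.
From mathcomp Require Import ring lra.

(** Write [e^t 1_p] for the function equal to [e^t] at [p] and to [0] elsewhere
    ([peak t p]).  Sup-convolution with it translates by [p] and multiplies by
    [e^t], so [(t, p) |-> F (e^t 1_p)] is a linear form on [R * R^n].

    The functions [e^Q] with [Q] superlinear (superadditive and positively
    homogeneous) are fixed by every dilation and idempotent for the
    sup-convolution.  Linearity thus gives [F (e^Q) = 2 F (e^Q)], so
    [F (e^Q) = 0] ([functional_expR_superlinear]).  These functions may be
    unbounded.  When [p] has a nonzero first coordinate, a linear form [Q] with
    [Q p = t] exists, hence [e^t 1_p <= e^Q] and [F (e^t 1_p) <= 0] by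
    monotonicity.  A linear form that is nonpositive there is zero
    ([functional_peak]).

    A general [f] is then squeezed between two functions on which [F] vanishes.
    Below [f] lies the peak [f p 1_p], for any [p] with [f p > 0].  Above [f] lies
    [m e^(Q (x - p))], the sup-convolution of [m 1_p] with [e^Q], for some [m] and
    some continuous superlinear [Q] ([superlinear_majorant]).  The latter replaces
    the affine majorant of [ln f] that a separation theorem would give, and is
    built by hand in two steps.  Upper semicontinuity bounds [f] near [p], and
    log-concavity along rays turns this into [f (p + y) <= m e^(A |y|)].  The
    envelope [Q x = sup (t ln (f (p + y) / m) - A |x - t y|)], over [t > 0] and
    [f (p + y) > 0], is finite because of this growth bound, superlinear because
    [ln f] is concave, and [A]-Lipschitz. *)

Set Implicit Arguments.
Unset Strict Implicit.
Unset Printing Implicit Defensive.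
Import Order.TTheory GRing.Theory Num.Theory.
Import numFieldNormedType.Exports.
Local Open Scope classical_set_scope.
Local Open Scope ring_scope.

(** * Log-concave functions, semicontinuity and sup-convolution *)

Lemma continuous_upper_semicontinuous (T : topologicalType) (R : realType)
    (f : T -> R) : continuous f -> upper_semicontinuous f.
Proof.
move=> fc x a; rewrite lte_fin ltrNr => xa.
exists [set y | f y < - a] => [|y /=]; last by rewrite lte_fin ltrNr.
have := @cvgr_lt _ _ _ _ f (f x) (fc x) _ xa; apply.
Qed.

Lemma lipschitz_continuous (R : realType) (V : normedModType R)
    (f : V -> R) (A : R) :
  (forall x y, f x - f y <= A * `|x - y|) -> continuous f.
Proof.
move=> fA x; apply/cvgrPdist_le => e e0.
have A1 : 0 < `|A| + 1 by rewrite ltr_pwDr.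
near=> y.
apply: (@le_trans _ _ ((`|A| + 1) * `|x - y|)).
  have AA : A * `|x - y| <= (`|A| + 1) * `|x - y|.
    by rewrite ler_wpM2r// (le_trans (ler_norm A))// lerDl.
  rewrite ler_norml lerNl opprB !(le_trans (fA _ _))//.
  by rewrite distrC.
rewrite -ler_pdivlMl//; near: y; apply: cvgr_dist_le; first exact: cvg_id.
by rewrite mulr_gt0 ?invr_gt0.
Unshelve. all: by end_near. Qed.

Lemma upper_semicontinuous_locally_bounded (R : realType)
    (V : normedModType R) (f : V -> R) (p : V) :
  upper_semicontinuous f ->
  exists2 r, 0 < r & forall x, `|x| <= r -> f (p + x) <= f p + 1.
Proof.
move=> /(_ p (- (f p + 1)))[|W /nbhs_ballP[e/= e0 eW] Wf].
  by rewrite lte_fin ltrN2 ltrDl.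
exists (e / 2) => [|x xe]; first by rewrite divr_gt0.
have /eW/Wf : ball p e (p + x).
  rewrite -ball_normE /= opprD addNKr normrN; apply: le_lt_trans xe _.
  by rewrite ltr_pdivrMr// ltr_pMr// ltr1n.
by rewrite lte_fin ltrN2 => /ltW.
Qed.

(** Restricting to [0 < l < 1] matters for functions that vanish somewhere,
    since [0 `^ 0 = 1]. *)
Lemma log_concave_in01 (R : realType) (n : nat) (f : 'rV[R]_n -> R) :
  (forall x, 0 <= f x) -> (exists x, f x != 0) ->
  (forall (x y : 'rV[R]_n) (l : R), 0 < l < 1 ->
    f x `^ (1 - l) * f y `^ l <= f ((1 - l) *: x + l *: y)) ->
  log_concave f.
Proof.
move=> f0 fn0 fc; split => // x y l /andP[l0 l1].
have [->|l_neq0] := eqVneq l 0.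
  by rewrite subr0 scale1r scale0r addr0 powRr0 mulr1 powRr1.
have [->|l_neq1] := eqVneq l 1.
  by rewrite subrr scale1r scale0r add0r powRr0 mul1r powRr1.
by apply: fc; rewrite lt_neqAle eq_sym l_neq0 l0 lt_neqAle l_neq1.
Qed.

Section convolution.
Context (R : realType) (n : nat).
Implicit Types (f g : 'rV[R]_n -> R) (h : LC R n).

Lemma LC_ge0 h x : 0 <= h x.
Proof. by case: (LC_log_concave h). Qed.

Lemma dilation1 f : (forall x, 0 <= f x) -> dilation 1 f = f.
Proof.
by move=> f0; apply/funext => x; rewrite /dilation invr1 scale1r powRr1.
Qed.

Lemma sup_convolution_raw_max f g (x : 'rV[R]_n) (m : R) :
  (forall y, f y * g (x - y) <= m) -> (exists y, f y * g (x - y) = m) ->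
  sup_convolution_raw f g x = m%:E.
Proof.
move=> ub [y ym]; apply/le_anti/andP; split.
  by apply: ge_ereal_sup => _ [z _ <-]; rewrite lee_fin.
by apply: ereal_sup_ubound; exists y => //; rewrite ym.
Qed.

Lemma sup_convolution_LC f g h :
  (forall x, sup_convolution_raw f g x = (h x)%:E) ->
  sup_convolution f g = (fun x => (h x)%:E).
Proof.
move=> fgh; rewrite /sup_convolution.
have -> : sup_convolution_raw f g = EFin \o h by apply/funext => x; exact: fgh.
by rewrite usc_hull_id//; exact: LC_usc.
Qed.

End convolution.

(** * Exponentials of constants on a point *)

Section peak.
Context (R : realType) (n : nat).
Implicit Types (t : R) (p x : 'rV[R]_n).

Definition peak t p : 'rV[R]_n -> R := fun x => if x == p then expR t else 0.

Lemma peak_ge0 t p x : 0 <= peak t p x.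
Proof. by rewrite /peak; case: ifP => // _; exact: expR_ge0. Qed.

Lemma peak_log_concave t p : log_concave (peak t p).
Proof.
apply: log_concave_in01 => [x||x y l /andP[l0 l1]]; first exact: peak_ge0.
  by exists p; rewrite /peak eqxx gt_eqF ?expR_gt0.
have l1' : 1 - l != 0 by rewrite subr_eq0 eq_sym lt_eqF.
rewrite {1 2}/peak; case: (eqVneq x p) => [->|_]; last first.
  by rewrite powR0// mul0r peak_ge0.
case: (eqVneq y p) => [->|_]; last by rewrite powR0 ?mulr0 ?peak_ge0 ?gt_eqF.
rewrite -scalerDl subrK scale1r /peak eqxx -!expRM -expRD.
by rewrite -mulrDr subrK mulr1.
Qed.

Lemma peak_usc t p : upper_semicontinuous (peak t p).
Proof.
move=> x a; rewrite lte_fin /peak; case: (eqVneq x p) => [->|xp] ax.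
  exists setT; first exact: filterT.
  move=> y _; rewrite lte_fin (lt_le_trans ax)// lerN2.
  by case: ifP => // _; exact: expR_ge0.
exists (~` [set p]); last by move=> y /eqP/negbTE ->; rewrite lte_fin.
apply: open_nbhs_nbhs; split; last exact/eqP.
rewrite openC; apply: accessible_closed_set1; apply: hausdorff_accessible.
exact: norm_hausdorff.
Qed.

Definition peakLC t p : LC R n := MkLC (peak_log_concave t p) (@peak_usc t p).

Lemma dilation_peak a t p :
  0 < a -> dilation a (peak t p) = peak (a * t) (a *: p).
Proof.
move=> a0; apply/funext => x; rewrite /dilation /peak.
have a_neq0 : a != 0 by rewrite gt_eqF.
have -> : (a^-1 *: x == p) = (x == a *: p).
  apply/eqP/eqP => [<-|->]; first by rewrite scalerA divff// scale1r.
  by rewrite scalerA mulVf// scale1r.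
by case: ifP => _; rewrite ?powR0// -expRM mulrC.
Qed.

Lemma sup_convolution_raw_peak t p (g : 'rV[R]_n -> R) x :
  (forall y, 0 <= g y) ->
  sup_convolution_raw (peak t p) g x = (expR t * g (x - p))%:E.
Proof.
move=> g0; apply: sup_convolution_raw_max => [y|]; last first.
  by exists p; rewrite /peak eqxx.
rewrite /peak; case: (eqVneq y p) => [->//|_].
by rewrite mul0r mulr_ge0// expR_ge0.
Qed.

End peak.

(** * Exponentials of superlinear functions *)

Section superlinear.
Context (R : realType) (n : nat).
Implicit Types (Q : 'rV[R]_n -> R) (c : R) (p : 'rV[R]_n).

Definition superlinear Q : Prop :=
  (forall x y, Q x + Q y <= Q (x + y)) /\
  (forall a x, 0 < a -> Q (a *: x) = a * Q x).

Lemma superlinear0 Q : superlinear Q -> Q 0 = 0.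
Proof. by move=> [_ /(_ 2 0 (ltr0n _ 2))]; rewrite scaler0 => ?; lra. Qed.

(** The shift by [p] and the factor [e^c] are what sup-convolution with
    [peak c p] does to [expR \o Q]. *)
Definition shifted_expR c p Q : 'rV[R]_n -> R :=
  fun x => expR c * expR (Q (x - p)).

Lemma shifted_expR_ge0 c p Q x : 0 <= shifted_expR c p Q x.
Proof. by rewrite mulr_ge0// expR_ge0. Qed.

Lemma shifted_expR0 Q x : shifted_expR 0 0 Q x = expR (Q x).
Proof. by rewrite /shifted_expR expR0 mul1r subr0. Qed.

Lemma shifted_expR_log_concave c p Q :
  superlinear Q -> log_concave (shifted_expR c p Q).
Proof.
move=> [Qadd Qhom]; apply: log_concave_in01 => [x||x y l /andP[l0 l1]].
- exact: shifted_expR_ge0.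
- by exists 0; rewrite gt_eqF// mulr_gt0// expR_gt0.
have l1' : 0 < 1 - l by rewrite subr_gt0.
rewrite /shifted_expR -!expRD -!expRM -expRD ler_expR.
have -> : (1 - l) *: x + l *: y - p = (1 - l) *: (x - p) + l *: (y - p).
  by rewrite !scalerBr addrACA -opprD -scalerDl subrK scale1r.
by apply: le_trans (lerD (lexx c) (Qadd _ _)); rewrite !Qhom//; lra.
Qed.

End superlinear.

Lemma continuous_shifted_expR (R : realType) (V : normedModType R) (c : R)
    (p : V) (Q : V -> R) :
  continuous Q -> continuous (fun x => expR c * expR (Q (x - p))).
Proof.
move=> Qc x; apply: cvgM; first exact: cvg_cst.
apply: (cvg_comp (fun y => Q (y - p)) expR); last exact: continuous_expR.
apply: (cvg_comp (fun y => y - p) Q); last exact: Qc.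
by apply: cvgB; [exact: cvg_id|exact: cvg_cst].
Qed.

Lemma shifted_expR_usc (R : realType) (n : nat) (c : R) (p : 'rV[R]_n)
    (Q : 'rV[R]_n -> R) :
  continuous Q -> upper_semicontinuous (shifted_expR c p Q).
Proof.
move=> Qc; apply: continuous_upper_semicontinuous.
exact: continuous_shifted_expR.
Qed.

Definition shifted_expRLC (R : realType) (n : nat) (c : R) (p : 'rV[R]_n)
    (Q : 'rV[R]_n -> R) (Ql : superlinear Q) (Qc : continuous Q) : LC R n :=
  MkLC (shifted_expR_log_concave c p Ql) (@shifted_expR_usc R n c p Q Qc).

(** * The functional on peaks and on exponentials of superlinear functions *)

Section functional.
Context (R : realType) (n : nat) (F : LC R n -> R).
Context (hlin : linear_functional F).

Lemma functional_peak_linear (t s a b : R) (p q : 'rV[R]_n) :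
  0 < a -> 0 < b ->
  F (peakLC (a * t + b * s) (a *: p + b *: q)) =
  a * F (peakLC t p) + b * F (peakLC s q).
Proof.
move=> a0 b0; apply: (hlin) => //; apply: sup_convolution_LC => x.
rewrite /= !dilation_peak// sup_convolution_raw_peak; last first.
  by move=> y; exact: peak_ge0.
congr EFin; rewrite /peak subr_eq [in RHS]addrC expRD.
by case: ifP => // _; rewrite mulr0.
Qed.

(** [e^Q] equals its own sup-convolution square: superadditivity bounds the
    supremum by [e^(Q x)], and it is reached at [y = x] because [Q 0 = 0]. *)
Lemma functional_expR_superlinear (Q : 'rV[R]_n -> R) (Ql : superlinear Q)
    (Qc : continuous Q) :
  F (shifted_expRLC 0 0 Ql Qc) = 0.
Proof.
set h := shifted_expRLC _ _ _ _.
suff : F h = 1 * F h + 1 * F h by lra.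
apply: hlin => //; apply: sup_convolution_LC => x.
rewrite dilation1; last exact: LC_ge0.
apply: sup_convolution_raw_max => [y|].
  rewrite /= !shifted_expR0 -expRD ler_expR.
  by rewrite (le_trans (Ql.1 _ _))// addrC subrK.
by exists x; rewrite /= !shifted_expR0 subrr superlinear0// expR0 mulr1.
Qed.

Lemma functional_shifted_expR (c : R) (p : 'rV[R]_n) (Q : 'rV[R]_n -> R)
    (Ql : superlinear Q) (Qc : continuous Q) :
  F (shifted_expRLC c p Ql Qc) = F (peakLC c p).
Proof.
rewrite (hlin (f := peakLC c p) (g := shifted_expRLC 0 0 Ql Qc)
  (h := shifted_expRLC c p Ql Qc) ltr01 ltr01).
  by rewrite functional_expR_superlinear mulr0 addr0 mul1r.
apply: sup_convolution_LC => x; rewrite !dilation1; try exact: LC_ge0.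
rewrite sup_convolution_raw_peak; last exact: LC_ge0.
by rewrite /= shifted_expR0.
Qed.

Context (hn : (1 <= n)%N) (hincr : increasing_functional F).

(** At [p = 0] no function [e^Q] dominates [e^t 1_p] for [t > 0], because
    [Q 0 = 0].  Points whose first coordinate vanishes are therefore reached by
    additivity, as sums of two points where it does not. *)
Lemma functional_peak (t : R) (p : 'rV[R]_n) : F (peakLC t p) = 0.
Proof.
pose j := Ordinal hn.
have F00 : F (peakLC 0 0) = 0.
  have := functional_peak_linear 0 0 0 0 ltr01 ltr01.
  by rewrite !mulr0 !scaler0 !addr0; lra.
have FD s1 s2 q1 q2 : F (peakLC (s1 + s2) (q1 + q2)) =
    F (peakLC s1 q1) + F (peakLC s2 q2).
  have := functional_peak_linear s1 s2 q1 q2 ltr01 ltr01.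
  by rewrite !mul1r !scale1r.
have FN s q : F (peakLC (- s) (- q)) = - F (peakLC s q).
  by apply/eqP; rewrite -addr_eq0 -FD !addNr F00.
have Fle0 s (q : 'rV[R]_n) : q 0 j != 0 -> F (peakLC s q) <= 0.
  (* The linear form along coordinate [j] with value [s] at [q]. *)
  move=> qj; pose Q (x : 'rV[R]_n) := s / q 0 j * x 0 j.
  have Ql : superlinear Q.
    split=> [x y|a x _]; rewrite /Q !mxE; first by rewrite mulrDr.
    by rewrite mulrCA.
  have Qc : continuous Q.
    move=> x; apply: (cvg_comp (fun x : 'rV[R]_n => x 0 j) ( *%R _)).
      exact: coord_continuous.
    exact: mulrl_continuous.
  rewrite -(functional_expR_superlinear Ql Qc); apply: hincr => x /=.
  rewrite shifted_expR0 /peak; case: eqP => [->|_]; last exact: expR_ge0.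
  by rewrite /Q divfK.
have F0 s (q : 'rV[R]_n) : q 0 j != 0 -> F (peakLC s q) = 0.
  move=> qj; apply/le_anti; rewrite Fle0//= -oppr_le0 -FN Fle0//.
  by rewrite mxE oppr_eq0.
have [pj|/F0//] := eqVneq (p 0 j) 0.
pose e : 'rV[R]_n := const_mx 1.
have -> : peakLC t p = peakLC (t + 0) ((p + e) + (- e)).
  by rewrite addr0 addrK.
by rewrite FD !F0 ?addr0// !mxE ?pj ?add0r ?oppr_eq0 oner_neq0.
Qed.

End functional.

(** * A superlinear majorant of a log-concave function *)

(** Beyond radius [r], log-concavity on the segment from [0] to [x] compares
    [u x] with [u] at the point of that segment of norm [r], where the local
    bound [m] holds. *)
Lemma log_concave_growth (R : realType) (n : nat) (u : 'rV[R]_n -> R)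
    (m r : R) :
  log_concave u -> 0 < u 0 -> 0 < r -> (forall x, `|x| <= r -> u x <= m) ->
  forall x, 0 < u x -> ln (u x) - ln m <= (ln m - ln (u 0)) / r * `|x|.
Proof.
move=> [_ _ uc] u00 r0 ur x ux.
have u0m : u 0 <= m by apply: ur; rewrite normr0 ltW.
have m0 : 0 < m by exact: lt_le_trans u0m.
have mu : ln (u 0) <= ln m by rewrite ler_ln.
have [xr|xr] := leP `|x| r.
  apply: (@le_trans _ _ 0); first by rewrite subr_le0 ler_ln// ur.
  by rewrite mulr_ge0// mulr_ge0 ?invr_ge0 ?subr_ge0// ltW.
have x0 : 0 < `|x| by exact: lt_trans xr.
pose l := r / `|x|.
have l0 : 0 < l by rewrite divr_gt0.
have l1 : l <= 1 by rewrite ler_pdivrMr// mul1r ltW.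
have : u 0 `^ (1 - l) * u x `^ l <= m.
  apply: le_trans (uc 0 x l _) _; first by rewrite ltW.
  apply: ur; rewrite scaler0 add0r normrZ gtr0_norm// /l divfK//.
  by rewrite gt_eqF.
rewrite -ler_ln ?posrE ?mulr_gt0 ?powR_gt0// lnM ?posrE ?powR_gt0//.
rewrite !ln_powR => H.
have -> : (ln m - ln (u 0)) / r * `|x| = (ln m - ln (u 0)) / l.
  by rewrite /l invf_div mulrA mulrAC.
rewrite ler_pdivlMr//; nra.
Qed.

Section envelope.
Context (R : realType) (n : nat) (u : 'rV[R]_n -> R) (m A : R).
Context (ulc : log_concave u) (u0 : 0 < u 0) (A0 : 0 <= A).
Context (growth : forall x, 0 < u x -> ln (u x) - ln m <= A * `|x|).

Definition envelope_values (x : 'rV[R]_n) : set R :=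
  [set v | exists t y, [/\ 0 < t, 0 < u y &
                           v = t * (ln (u y) - ln m) - A * `|x - t *: y|]].

(** The least positively homogeneous concave majorant of [ln (u / m)] would be
    [x |-> sup_t t ln (u (x / t) / m)], but it is [-oo] wherever [u] vanishes
    along the ray through [x].  Sup-convolution with [- A |x|] makes it finite
    and Lipschitz while keeping it superlinear. *)
Definition envelope (x : 'rV[R]_n) : R := sup (envelope_values x).

Lemma envelope_values_ub x : ubound (envelope_values x) (A * `|x|).
Proof.
move=> _ [t [y [t0 uy ->]]].
have := growth uy; rewrite -(ler_pM2l t0) => H.
have : `|t *: y| <= `|x| + `|x - t *: y|.
  by rewrite -{1}(subKr x (t *: y)) ler_normB.
rewrite normrZ gtr0_norm// => /(ler_wpM2l A0); nra.
Qed.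

Lemma le_envelope x t y : 0 < t -> 0 < u y ->
  t * (ln (u y) - ln m) - A * `|x - t *: y| <= envelope x.
Proof.
move=> t0 uy; apply: ub_le_sup; last by exists t, y.
by exists (A * `|x|); exact: envelope_values_ub.
Qed.

Lemma envelope_le x c :
  (forall t y, 0 < t -> 0 < u y ->
    t * (ln (u y) - ln m) - A * `|x - t *: y| <= c) -> envelope x <= c.
Proof.
move=> H; apply: ge_sup => [|_ [t [y [t0 uy ->]]]]; last exact: H.
by exists (1 * (ln (u 0) - ln m) - A * `|x - 1 *: 0|), 1, 0.
Qed.

Lemma envelope_homogeneous a x : 0 < a -> envelope (a *: x) = a * envelope x.
Proof.
have le_hom b y : 0 < b -> b * envelope y <= envelope (b *: y).
  move=> b0; rewrite -ler_pdivlMl//; apply: envelope_le => t z t0 uz.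
  rewrite ler_pdivlMl//; apply: le_trans (le_envelope (b *: y) (t := b * t) _ uz).
    by rewrite -scalerA -scalerBr normrZ gtr0_norm//; lra.
  exact: mulr_gt0.
move=> a0; apply/le_anti/andP; split; last exact: le_hom.
rewrite -ler_pdivrMl//; have := le_hom a^-1 (a *: x).
rewrite scalerA mulVf ?gt_eqF// scale1r; apply.
by rewrite invr_gt0.
Qed.

Lemma envelope_superadditive x y :
  envelope x + envelope y <= envelope (x + y).
Proof.
rewrite -lerBrDr; apply: envelope_le => t a t0 ua.
rewrite lerBrDr addrC -lerBrDr; apply: envelope_le => s b s0 ub.
rewrite lerBrDr.
(* The candidates [(t, a)] for [x] and [(s, b)] for [y] combine into the
   candidate [(t + s, c)] for [x + y], where [(t + s) c = t a + s b]. *)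
have ts0 : 0 < t + s by rewrite addr_gt0.
have ts_neq0 : t + s != 0 by rewrite gt_eqF.
pose l := s / (t + s).
have l1 : 1 - l = t / (t + s) by rewrite /l; field.
pose c := (1 - l) *: a + l *: b.
have cE : (t + s) *: c = t *: a + s *: b.
  by rewrite scalerDr !scalerA l1 /l ![(t + s) * _]mulrC !divfK.
have l01 : 0 <= l <= 1.
  apply/andP; split; first by rewrite divr_ge0// ltW.
  by rewrite ler_pdivrMr// mul1r lerDr ltW.
have [_ _ /(_ a b l l01)] := ulc; rewrite -/c => uab.
have uc : 0 < u c by apply: lt_le_trans uab; rewrite mulr_gt0 ?powR_gt0.
move: uab; rewrite -ler_ln ?posrE ?mulr_gt0 ?powR_gt0//.
rewrite lnM ?posrE ?powR_gt0// !ln_powR l1 /l -(ler_pM2l ts0) => uab.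
apply: le_trans (le_envelope (x + y) ts0 uc).
have : `|x + y - (t + s) *: c| <= `|x - t *: a| + `|y - s *: b|.
  by rewrite cE opprD addrACA ler_normD.
move=> /(ler_wpM2l A0).
have : (t + s) * (t / (t + s) * ln (u a) + s / (t + s) * ln (u b)) =
  t * ln (u a) + s * ln (u b) by field.
nra.
Qed.

Lemma envelope_superlinear : superlinear envelope.
Proof.
by split; [exact: envelope_superadditive|exact: envelope_homogeneous].
Qed.

Lemma envelope_lipschitz x y : envelope x - envelope y <= A * `|x - y|.
Proof.
rewrite lerBlDr; apply: envelope_le => t a t0 ua.
rewrite -lerBlDl; apply: le_trans (le_envelope y t0 ua).
have : `|y - t *: a| <= `|x - y| + `|x - t *: a|.
  rewrite -[`|x - y|]normrN opprB; apply: le_trans (ler_normD _ _).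
  by rewrite addrA subrK.
move=> /(ler_wpM2l A0); lra.
Qed.

(** The candidate [t = 1], [y = x] in the supremum. *)
Lemma le_expR_envelope x : 0 < m -> u x <= m * expR (envelope x).
Proof.
move=> m0; case: ulc => uge0 _ _.
have [<-|ux_neq0] := eqVneq 0 (u x); first by rewrite mulr_ge0 ?expR_ge0 ?ltW.
have ux : 0 < u x by rewrite lt_neqAle ux_neq0 uge0.
rewrite -ler_ln ?posrE ?mulr_gt0 ?expR_gt0// lnM ?posrE ?expR_gt0// expRK.
rewrite -lerBlDl; have := le_envelope x ltr01 ux.
by rewrite mul1r scale1r subrr normr0 mulr0 subr0.
Qed.

End envelope.

Lemma superlinear_majorant (R : realType) (n : nat) (f : LC R n)
    (p : 'rV[R]_n) :
  0 < f p -> exists (c : R) (Q : 'rV[R]_n -> R),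
    [/\ superlinear Q, continuous Q & forall x, f x <= shifted_expR c p Q x].
Proof.
move=> fp.
have [r r0 fr] := upper_semicontinuous_locally_bounded p (@LC_usc _ _ f).
pose u x := f (p + x); pose m := f p + 1.
have m0 : 0 < m by rewrite addr_gt0.
have u0E : u 0 = f p by rewrite /u addr0.
have u0 : 0 < u 0 by rewrite u0E.
have ulc : log_concave u.
  have [_ _ fc] := LC_log_concave f.
  split=> [x||x y l l01]; first exact: LC_ge0.
    by exists 0; rewrite gt_eqF.
  apply: le_trans (fc _ _ _ l01) _.
  by rewrite !scalerDr addrACA -scalerDl subrK scale1r.
pose A := (ln m - ln (u 0)) / r.
have A0 : 0 <= A.
  by apply: divr_ge0; [rewrite subr_ge0 ler_ln ?u0E ?lerDl|exact: ltW].
have growth := log_concave_growth ulc u0 r0 fr.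
exists (ln m), (envelope u m A); split.
- exact: envelope_superlinear.
- by apply: (@lipschitz_continuous _ _ _ A); exact: envelope_lipschitz.
move=> x; rewrite /shifted_expR lnK ?posrE//.
have := le_expR_envelope ulc A0 growth (x - p) m0.
by rewrite /u addrC subrK.
Qed.

Unset Implicit Arguments.

(** * Vanishing of the functional *)

Theorem theorem1p3 (R : realType) (n : nat) (hn : (1 <= n)%N)
    (F : LC R n -> R) (hlin : linear_functional F)
    (hincr : increasing_functional F) :
  forall f : LC R n, F f = 0.
Proof.
move=> f; have [_ [p fp_neq0] _] := LC_log_concave f.
have fp : 0 < f p by rewrite lt_neqAle eq_sym fp_neq0 LC_ge0.
have peak0 := functional_peak hlin hn hincr.
apply/le_anti/andP; split; last first.
  rewrite -(peak0 (ln (f p)) p); apply: hincr => x /=; rewrite /peak.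
  by case: eqP => [->|_]; rewrite ?lnK ?posrE ?LC_ge0.
have [c [Q [Ql Qc fQ]]] := superlinear_majorant fp.
rewrite -(peak0 c p) -(functional_shifted_expR hlin c p Ql Qc).
exact: hincr.
Qed.
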